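(* Let $l^{(2)}(t)$ and $u^{(2)}(t)$ be functions such that $0<l^{(2)}(t)\le m^{(2)}_{\lambda}(t)\le u^{(2)}(t)$ for all $\lambda\ge 1$ and any $t$. Let $\psi:(0,\infty)\to(0,\infty)$ and let $\delta_{\psi}(\mathbf{X})=\psi(D)X_2$ be a scale equivariant estimator of $\theta_2$. Let $\psi_{2,0}:(0,\infty)\to(0,\infty)$ be such that $\psi(t)<\psi_{2,0}(t)\le\frac{1}{u^{(2)}(t)}$ whenever $\psi(t)<\frac{1}{u^{(2)}(t)}$; $\frac{1}{l^{(2)}(t)}\le\psi_{2,0}(t)<\psi(t)$ whenever $\frac{1}{l^{(2)}(t)}<\psi(t)$; and $\psi_{2,0}(t)=\psi(t)$ whenever $\frac{1}{u^{(2)}(t)}\le\psi(t)\le\frac{1}{l^{(2)}(t)}$. Let $\delta_{\psi_{2,0}}(\mathbf{X})=\psi_{2,0}(D)X_2$. If $P_{\boldsymbol\theta}\left[\frac{1}{u^{(2)}(D)}\le\psi(D)\le\frac{1}{l^{(2)}(D)}\right]<1$ for all $\boldsymbol\theta\in\Theta_0$, then $GPN(\delta_{\psi_{2,0}},\delta_{\psi};\boldsymbol\theta)>\frac12$ for all $\boldsymbol\theta\in\Theta_0$.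
   Context: $f$ is a specified Lebesgue probability density, and $\mathbf{X}=(X_1,X_2)$ has joint p.d.f. $\frac{1}{\theta_1\theta_2}f\left(\frac{x_1}{\theta_1},\frac{x_2}{\theta_2}\right)$, where $\boldsymbol\theta=(\theta_1,\theta_2)\in\Theta_0=\{(t_1,t_2)\in(0,\infty)^2:t_1\le t_2\}$ is unknown; the support of $\mathbf{X}$ is assumed to be a subset of $(0,\infty)^2$. Put $\lambda=\theta_2/\theta_1\ge1$, $D=X_2/X_1$, $Z_2=X_2/\theta_2$. The p.d.f. of $D$ is $f_D(t|\lambda)=\int_0^\infty\frac{\lambda y}{t^2}f\left(\frac{\lambda y}{t},y\right)dy$, and the conditional p.d.f. of $Z_2$ given $D=t$ is $f_\lambda(s|t)=\frac{\lambda s}{t^2}f\left(\frac{\lambda s}{t},s\right)/f_D(t|\lambda)$ ($t$ in the support of $D$). $m^{(2)}_\lambda(t)$ denotes the median of this conditional distribution, so $\int_0^{m^{(2)}_\lambda(t)}sf(\frac{\lambda s}{t},s)\,ds=\frac12\int_0^\infty sf(\frac{\lambda s}{t},s)\,ds$. General loss function: $L_2(\boldsymbol\theta,a)=W(a/\theta_2)$, $a\in(0,\infty)$, where $W:(0,\infty)\to[0,\infty)$ satisfies $W(1)=0$, $W$ strictly decreasing on $(0,1)$ and strictly increasing on $(1,\infty)$. For estimators $\delta_1,\delta_2$ of $\theta_2$, $GPN(\delta_1,\delta_2;\boldsymbol\theta)=P_{\boldsymbol\theta}[L_2(\boldsymbol\theta,\delta_1)<L_2(\boldsymbol\theta,\delta_2)]+\frac12P_{\boldsymbol\theta}[L_2(\boldsymbol\theta,\delta_1)=L_2(\boldsymbol\theta,\delta_2)]$.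 All functions defining estimators are understood to be Borel measurable.
   Formalization: The loss W is additionally assumed continuous at 1 (for W jumping at 1 the claim can fail, with GPN exactly 1/2); if the conditional median is not unique, the bounds l and u are required for every median. *)

(* Defs.v *)
From HB Require Import structures.
From mathcomp Require Import all_boot all_order all_algebra.
From mathcomp Require Import all_classical all_reals all_analysis.
Import Order.TTheory GRing.Theory Num.Theory.
Import numFieldNormedType.Exports.
Set Implicit Arguments.
Unset Strict Implicit.
Unset Printing Implicit Defensive.
Local Open Scope classical_set_scope.
Local Open Scope ring_scope.

Definition lebesgue2 (R : realType) :=
  ((@lebesgue_measure R) \x (@lebesgue_measure R))%E.

Definition planar_pdf (R : realType) (f : R * R -> R) : Prop :=
  [/\ measurable_fun setT f,
      forall x, 0 <= f x
    & (\int[@lebesgue2 R]_x (f x)%:E = 1)%E].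

Definition Theta0 (R : realType) : set (R * R) :=
  [set th | [/\ 0 < th.1, 0 < th.2 & th.1 <= th.2]].

Definition scale_density (R : realType) (f : R * R -> R) (th x : R * R) : R :=
  (th.1 * th.2)^-1 * f (x.1 / th.1, x.2 / th.2).

(* The density of D = X2 / X1 at t when th.2 / th.1 = lam.  The integral is the
   real-valued one, which is 0 if the integral diverges; so [0 < ratio_density
   f lam t] says that the integral is positive and finite. *)
Definition ratio_density (R : realType) (f : R * R -> R) (lam t : R) : R :=
  \int[@lebesgue_measure R]_(y in `]0, +oo[)
    (lam * y / t ^+ 2 * f (lam * y / t, y)).

Definition ratio_support (R : realType) (f : R * R -> R) (lam : R) : set R :=
  [set t | 0 < t /\ 0 < ratio_density f lam t].

(* The conditional density at s of Z2 = X2 / th.2 given D = t. *)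
Definition cond_density (R : realType) (f : R * R -> R) (lam t s : R) : R :=
  lam * s / t ^+ 2 * f (lam * s / t, s) / ratio_density f lam t.

(* m is a median of the conditional law of Z2 given D = t; m need not be unique. *)
Definition cond_median (R : realType) (f : R * R -> R) (lam t m : R) : Prop :=
  \int[@lebesgue_measure R]_(s in `]0, m]) cond_density f lam t s = 2^-1.

(* W is only constrained on its domain (0, +oo).  Nothing here excludes a jump
   at 1, as for W x = 1 - x on (0, 1), W 1 = 0, W x = 1 + x on (1, +oo); with such
   a W an improved estimator may have GPN exactly 1/2. *)
Definition general_loss (R : realType) (W : R -> R) : Prop :=
  [/\ forall x, 0 < x -> 0 <= W x,
      W 1 = 0,
      forall x y, 0 < x -> x < y -> y < 1 -> W y < W x
    & forall x y, 1 < x -> x < y -> W x < W y].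

Definition loss2 (R : realType) (W : R -> R) (th : R * R) (a : R) : R :=
  W (a / th.2).

Definition GPN (R : realType) (d : measure_display) (T : measurableType d)
    (P : R * R -> probability T R) (X : T -> R * R) (W : R -> R)
    (delta1 delta2 : R * R -> R) (th : R * R) : \bar R :=
  (P th [set w | (loss2 W th (delta1 (X w)) < loss2 W th (delta2 (X w)))%R]
   + (2^-1)%:E *
     P th [set w | loss2 W th (delta1 (X w)) = loss2 W th (delta2 (X w))])%E.

Definition coord_ratio (R : realType) (x : R * R) : R := x.2 / x.1.

Definition scale_equivariant (R : realType) (psi : R -> R) (x : R * R) : R :=
  psi (coord_ratio x) * x.2.

(* Main.v *)
(* In the coordinates D = X2 / X1 and Z = X2 / th.2 the losses are
   W (psi20 D * Z) and W (psi D * Z).  Fix D = t with psi t <> psi20 t, say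
   psi t < psi20 t <= 1 / u t.  The new loss is the smaller one for all
   Z <= 1 / psi20 t and, W being continuous at 1, even for all Z up to some
   x > 1 / psi20 t >= u t.  As u t bounds every conditional median, the
   conditional distribution function exceeds 1/2 at x: otherwise, being
   continuous with limit 1, it would take the value 1/2 at some m >= x.  The other
   case is symmetric, so the conditional GPN given D = t is at least 1/2, and
   larger than 1/2 where psi and psi20 differ; then integrate over t. *)

Require Import Defs.
From HB Require Import structures.
From mathcomp Require Import all_boot all_order all_algebra.
From mathcomp Require Import all_classical all_reals all_analysis.
From mathcomp Require Import measurable_realfun lra ring.
Import Order.TTheory GRing.Theory Num.Theory.
Import numFieldNormedType.Exports.
Set Implicit Arguments.
Unset Strict Implicit.
Unset Printing Implicit Defensive.
Local Open Scope classical_set_scope.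
Local Open Scope ring_scope.

(** * Measurability of inversion and change of variables by dilations *)

Lemma measurable_funV (R : realType) : measurable_fun setT (@GRing.inv R).
Proof.
have n0E : [set x : R | x != 0] = ~` [set 0].
  by apply/seteqP; split=> x /= /eqP.
(* Inversion is continuous away from 0, and every function is measurable on the singleton of 0. *)
have -> : [set: R] = [set 0] `|` [set x : R | x != 0] by rewrite n0E setUv.
apply/measurable_funU => //; first by rewrite n0E; exact: measurableC.
split; first exact: measurable_fun_set1.
apply: open_continuous_measurable_fun.
  by rewrite n0E; apply: closed_openC; exact: closed_eq.
by move=> x /[!inE] /= x0; exact: inv_continuous.
Qed.

Section integral_change_of_variables.
Local Open Scope ereal_scope.

(** The image of Lebesgue measure under dilation by [c], multiplied by [c], gives every half-open
    interval its length, so it is Lebesgue measure again. *)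
Lemma ge0_integral_scale (R : realType) (c : R) (h : R -> \bar R) :
  (0 < c)%R -> measurable_fun setT h -> (forall x, 0 <= h x) ->
  \int[lebesgue_measure]_x h x = c%:E * \int[lebesgue_measure]_x h (c * x)%R.
Proof.
move=> c0 mh h0.
have mc : measurable_fun setT ( *%R c : R -> measurableTypeR R).
  exact: mulrl_measurable.
pose push := pushforward (@lebesgue_measure R) ( *%R c : R -> measurableTypeR R).
pose nu_of := mscale (NngNum (ltW c0)) push.
pose nu : {measure set (measurableTypeR R) -> \bar R} := nu_of mc.
transitivity (\int[nu]_x h x).
  apply: eq_measure_integral => A mA _; apply: lebesgue_measure_unique => //.
  move=> _ [[a b] _ <-].
  rewrite /nu /nu_of/= /mscale/= /push /pushforward.
    have -> : *%R c @^-1` `]a, b] = `](c^-1 * a)%R, (c^-1 * b)%R]%classic.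
    apply/seteqP; split=> x /=; rewrite !in_itv/= ltr_pdivrMl// ler_pdivlMl//.
  rewrite !lebesgue_measure_itv/= !lte_fin ltr_pM2l ?invr_gt0//.
  case: ifPn => _; last by rewrite mule0.
  by rewrite -!EFinB -EFinM -mulrBr mulrA divff ?gt_eqF// mul1r.
by rewrite /nu /nu_of ge0_integral_mscale//= ge0_integral_pushforward.
Qed.

(* For fixed x1 substitute x2 = x1 * t, exchange the integrals, then for fixed t
   substitute x1 = b / t * s: only dilations of the line are needed. *)
Lemma integral_quadrant (R : realType) (b : R) (g : R * R -> \bar R) :
  (0 < b)%R -> measurable_fun setT g -> (forall x, 0 <= g x) ->
  (forall x, ~ (0 < x.1 /\ 0 < x.2)%R -> g x = 0) ->
  \int[@lebesgue2 R]_x g x =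
  \int[lebesgue_measure]_(t in `]0%R, +oo[)
    \int[lebesgue_measure]_(s in `]0%R, +oo[)
      (((b / t) * (b / t * s))%:E * g (b / t * s, b * s)%R).
Proof.
move=> b0 mg g0 gQ.
(* The absolute value keeps the integrand nonnegative on the whole plane, as Tonelli requires; where
   [k] is nonzero, [z.1] is positive. *)
pose k (z : R * R) := `|z.1|%:E * g (z.1, z.1 * z.2)%R.
have k0 z : 0 <= k z by rewrite mule_ge0// lee_fin.
have mk : measurable_fun setT k.
  apply: emeasurable_funM.
    by apply/measurable_EFinP; exact: measurableT_comp.
  apply: (measurableT_comp mg); apply: measurable_fun_pair => //.
  exact: measurable_funM.
rewrite /lebesgue2 fubini_tonelli1//.
transitivity (\int[lebesgue_measure]_x \int[lebesgue_measure]_t k (x, t)).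
  apply: eq_integral => x _; rewrite /fubini_F /k/=.
  have [x0|x0] := ltP 0%R x.
    rewrite (@ge0_integral_scale R x)//; last exact: measurableT_comp.
    rewrite gtr0_norm// ge0_integralZl//.
    - apply: (measurableT_comp mg); apply: measurable_fun_pair => //.
    - by rewrite lee_fin ltW.
  have gx0 y : g (x, y) = 0 by rewrite gQ//= => -[+ _]; rewrite ltNge x0.
  by rewrite !integral0_eq// => y _; rewrite gx0 ?mule0.
have E :=
  fubini_tonelli (m1 := @lebesgue_measure R) (m2 := @lebesgue_measure R) k mk k0.
rewrite {}E.
rewrite [RHS]integral_mkcond.
apply: eq_integral => t _; rewrite patchE.
case: ifPn; rewrite ?inE ?notin_setE/= in_itv/= andbT.
  move=> t0; have bt0 : (0 < b / t)%R by rewrite divr_gt0.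
  have mkt : measurable_fun setT (fun x => k (x, t)) by exact: measurableT_comp.
  rewrite (ge0_integral_scale bt0 mkt)//.
  rewrite -ge0_integralZl//; last 2 first.
    by apply: (measurableT_comp mkt).
    by rewrite lee_fin ltW.
  rewrite [RHS]integral_mkcond; apply: eq_integral => s _.
  rewrite patchE; case: ifPn; rewrite ?inE ?notin_setE/= in_itv/= andbT /k/=.
    move=> s0; rewrite muleA -EFinM gtr0_norm ?(mulr_gt0 bt0)//.
    by have -> : (b / t * s * t = b * s)%R by rewrite mulrAC divfK// gt_eqF.
  move=> s0; rewrite [g _]gQ ?mule0//= => -[+ _].
  by rewrite (pmulr_rgt0 _ bt0).
move=> t0; apply: integral0_eq => x _; rewrite /k gQ ?mule0//= => -[x0].
by rewrite pmulr_rgt0.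
Qed.

End integral_change_of_variables.

(** * Measurability of the loss and strict comparison of two losses *)

Lemma quasiconvex_measurable (R : realType) (D : set R) (W : R -> R) :
  is_interval D ->
  (forall x y z, D x -> D z -> x < y < z -> W y <= Num.max (W x) (W z)) ->
  measurable_fun D W.
Proof.
(* Rays []-oo, r[] generate the Borel sets, and by quasiconvexity their preimages in [D] are
   intervals. *)
move=> iD qW; apply: (measurability (@RGenInftyO.G R)) => [|_ [_ [r ->] <-]].
  exact: RGenInftyO.measurableE.
apply: is_interval_measurable; apply/is_intervalPlt => x z [Dx Wx] [Dz Wz] y xyz.
split; first by apply: (iD x z) => //; case/andP: xyz => /ltW-> /ltW->.
move: Wx Wz; rewrite /= !in_itv/= => Wx Wz.
by rewrite (le_lt_trans (qW x y z Dx Dz xyz))// gt_max Wx Wz.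
Qed.

Section loss.
Context (R : realType) (W : R -> R).
Hypothesis hW : general_loss W.

(** The endpoint 1 can be included: the midpoint of [x] and 1 has a nonnegative loss that is already
    below [W x], and [W 1 = 0]. *)
Lemma loss_decr x y : 0 < x -> x < y -> y <= 1 -> W y < W x.
Proof.
case: hW => W0 W1 Wd _ x0 xy; rewrite le_eqVlt => /predU1P[y1|]; last exact: Wd.
have x1 : x < 1 by rewrite -y1.
rewrite y1 W1 (le_lt_trans (W0 ((x + 1) / 2) _))//; first by lra.
by apply: Wd => //; lra.
Qed.

Lemma loss_incr x y : 1 <= x -> x < y -> W x < W y.
Proof.
case: hW => W0 W1 _ Wi; rewrite le_eqVlt => /predU1P[<- y1|]; last exact: Wi.
rewrite W1 (le_lt_trans (W0 ((y + 1) / 2) _))//; first by lra.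
by apply: Wi => //; lra.
Qed.

Lemma loss_quasiconvex x y z : 0 < x -> x < y -> y < z ->
  W y <= Num.max (W x) (W z).
Proof.
move=> x0 xy yz; rewrite le_max; apply/orP.
have [y1|y1] := leP y 1; [left|right]; apply: ltW; first exact: loss_decr.
by apply: loss_incr => //; exact: ltW.
Qed.

Hypothesis W_cont1 : {for 1, continuous W}.

Lemma loss_small_near1 c : 0 < c -> exists2 e : R, 0 < e &
  forall y, `|1 - y| < e -> W y < c.
Proof.
move=> c0; have /cvgrPdist_lt /(_ c c0) := W_cont1.
case/nbhs_ballP => e /= e0 He; exists e => // y y1.
have := He y y1; have [_ -> _ _] := hW; rewrite sub0r normrN.
exact/le_lt_trans/ler_norm.
Qed.

(** As long as [b * s <= 1], monotonicity suffices. Slightly beyond, [W (b * s)] is small by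
    continuity at 1, whereas [a * s] is still bounded away from 1 and has a loss bounded below. *)
Lemma loss_better_low a b : 0 < a -> a < b -> exists2 x0 : R, b^-1 < x0 &
  forall s, 0 < s -> s <= x0 -> W (b * s) < W (a * s).
Proof.
move=> a0 ab; have b0 := lt_trans a0 ab.
have ab1 : a / b < 1 by rewrite ltr_pdivrMr ?mul1r.
have ab0 : 0 < a / b by rewrite divr_gt0.
(* A barrier strictly between [a / b] and 1; [W c] is the lower bound for the loss at [a * s]. *)
pose c := (1 + a / b) / 2.
have c1 : c < 1 by rewrite /c; lra.
have abc : a / b < c by rewrite /c; lra.
have c0 : 0 < c by lra.
have Wc : 0 < W c by have [_ <- _ _] := hW; apply: loss_decr.
have [e e0 He] := loss_small_near1 Wc.
(* The upper bound for [b * s]: the first term keeps it within [e] of 1, the second keeps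
   [a * s = b * s * (a / b)] at most [c]. *)
pose r := Num.min (1 + e / 2) (c / (a / b)).
have r1 : 1 < r.
  by rewrite lt_min ltr_pdivlMr// mul1r abc andbT; lra.
exists (r / b); first by rewrite -[ltLHS]mul1r ltr_pM2r ?invr_gt0.
move=> s s0; rewrite ler_pdivlMr// mulrC => bsr.
have [bs1|bs1] := leP (b * s) 1.
  by apply: loss_decr; rewrite ?mulr_gt0// ltr_pM2r.
have asc : a * s <= c.
  have : b * s <= c / (a / b) by rewrite (le_trans bsr)// ge_min lexx orbT.
  rewrite ler_pdivlMr//; apply: le_trans.
  by rewrite le_eqVlt; apply/orP; left; apply/eqP; field; rewrite gt_eqF.
apply: (@lt_le_trans _ _ (W c)).
  apply: He; rewrite ltr0_norm ?subr_lt0// opprB.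
  have : b * s <= 1 + e / 2 by rewrite (le_trans bsr)// ge_min lexx.
  by lra.
move: asc; rewrite le_eqVlt => /predU1P[->//|asc].
by apply/ltW/loss_decr; rewrite ?mulr_gt0// ltW.
Qed.

(** The mirror image of [loss_better_low]: the barrier lies above 1 and [b * s] may fall slightly
    below 1. Positivity of [x0] keeps all arguments of [W] in its domain. *)
Lemma loss_better_high a b : 0 < b -> b < a -> exists x0 : R,
  [/\ 0 < x0, x0 < b^-1 & forall s, x0 <= s -> W (b * s) < W (a * s)].
Proof.
move=> b0 ba; have a0 := lt_trans b0 ba.
have ab1 : 1 < a / b by rewrite ltr_pdivlMr ?mul1r.
pose c := (1 + a / b) / 2.
have c1 : 1 < c by rewrite /c; lra.
have abc : c < a / b by rewrite /c; lra.
have c0 : 0 < c by lra.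
have Wc : 0 < W c by have [_ <- _ _] := hW; apply: loss_incr.
have [e e0 He] := loss_small_near1 Wc.
pose r := Num.max (1 - e / 2) (c / (a / b)).
have r0 : 0 < r by rewrite lt_max divr_gt0 ?orbT// divr_gt0.
have r1 : r < 1.
  by rewrite gt_max ltr_pdivrMr ?divr_gt0// mul1r abc andbT; lra.
exists (r / b); split; first by rewrite divr_gt0.
  by rewrite -[ltRHS]mul1r ltr_pM2r ?invr_gt0.
move=> s; rewrite ler_pdivrMr// mulrC => bsr.
have s0 : 0 < s by rewrite -(pmulr_rgt0 _ b0) (lt_le_trans r0).
have [bs1|bs1] := leP 1 (b * s).
  by apply: loss_incr; rewrite ?mulr_gt0// ltr_pM2r.
have asc : c <= a * s.
  have : c / (a / b) <= b * s by rewrite (le_trans _ bsr)// le_max lexx orbT.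
  rewrite ler_pdivrMr ?divr_gt0// => /le_trans; apply.
  by rewrite le_eqVlt; apply/orP; left; apply/eqP; field; rewrite gt_eqF.
apply: (@lt_le_trans _ _ (W c)).
  apply: He; rewrite gtr0_norm ?subr_gt0//.
  have : 1 - e / 2 <= b * s by rewrite (le_trans _ bsr)// le_max lexx.
  by lra.
move: asc; rewrite le_eqVlt => /predU1P[<-//|asc].
by apply/ltW/loss_incr => //; rewrite ltW.
Qed.

End loss.

(** * Strict inequality between integrals *)

Section strict_comparison.
Local Open Scope ereal_scope.

(** If the conclusion failed, both functions would be integrable and [g - f], nonnegative almost
    everywhere, would have integral 0. Then [f = g] almost everywhere, which forces [f] to vanish
    almost everywhere on [N]. Comparing only where [f] is finite is enough because an integrable
    function is finite almost everywhere. *)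
Lemma ge0_lt_integral d (T : measurableType d) (R : realType)
    (mu : {measure set T -> \bar R}) (D N : set T) (f g : T -> \bar R) :
  measurable D -> measurable N -> N `<=` D ->
  measurable_fun D f -> measurable_fun D g ->
  (forall x, D x -> 0 <= f x) -> (forall x, D x -> 0 <= g x) ->
  \int[mu]_(x in D) f x < +oo ->
  (forall x, D x -> f x < +oo -> f x <= g x) ->
  (forall x, N x -> 0 < f x -> f x < +oo -> f x < g x) ->
  0 < \int[mu]_(x in N) f x ->
  \int[mu]_(x in D) f x < \int[mu]_(x in D) g x.
Proof.
move=> mD mN ND mf mg f0 g0 foo fg fgN Nf; rewrite ltNge; apply/negP => gf.
have ifin (h : T -> \bar R) : measurable_fun D h -> (forall x, D x -> 0 <= h x) ->
    \int[mu]_(x in D) h x < +oo -> mu.-integrable D h.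
  move=> mh h0 hoo; apply/integrableP; split => //.
  by under eq_integral => x /[!inE] Dx do rewrite gee0_abs ?h0//.
have intf := ifin f mf f0 foo.
have intg := ifin g mg g0 (le_lt_trans gf foo).
have mgf : measurable_fun D (g \- f) by exact: emeasurable_funB.
have fae := integrable_ae mD intf.
have : \int[mu]_(x in D) `|(g \- f) x| = 0.
  apply/eqP; rewrite eq_le integral_ge0// andbT.
  rewrite (ae_eq_integral (g \- f))//.
  - rewrite integralB// leeBlDr ?add0e//.
    by rewrite ge0_fin_numE ?integral_ge0.
  - exact: measurableT_comp.
  - apply: filterS fae => x fx Dx; rewrite /= gee0_abs// sube_ge0 ?fx//.
    by apply: fg => //; rewrite ltey_eq fx.
move/(ae_eq_integral_abs mu mD mgf) => gf0.
have : \int[mu]_(x in N) f x = \int[mu]_(x in N) (cst 0) x.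
  apply: ae_eq_integral => //; first exact: measurable_funS mf.
  apply: filterS2 fae gf0 => x fx gfx Nx; apply/eqP; have Dx := ND _ Nx.
  rewrite eq_le f0// andbT leNgt; apply/negP => fx0.
  have := fgN x Nx fx0; rewrite ltey_eq fx// => /(_ isT).
  by rewrite -sube_gt0 [X in 0 < X]gfx// ltxx.
by rewrite integral_cst// mul0e => Nf0; rewrite Nf0 ltxx in Nf.
Qed.

End strict_comparison.

(** * Unnormalized distribution functions on the half line and their half-mass points *)

Section half_mass.
Context (R : realType) (h : R -> R) (I : R).
Hypotheses (mh : measurable_fun setT h) (h0 : forall x, 0 < x -> 0 <= h x).
Hypothesis hI : (\int[lebesgue_measure]_(x in `]0%R, +oo[) (h x)%:E = I%:E)%E.

Let F x := \int[lebesgue_measure]_(s in `]0, x]) h s.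

Let sub0oo x : (`]0, x] : set R) `<=` `]0, +oo[.
Proof. by apply: subset_itvl; rewrite bnd_simp. Qed.

Lemma integrable_half_line : lebesgue_measure.-integrable `]0, +oo[ (EFin \o h).
Proof.
apply/integrableP; split; first by apply/measurable_EFinP; exact: measurable_funTS.
rewrite [ltLHS](_ : _ = I%:E) ?ltry// -hI; apply: eq_integral => x /[!inE]/=.
by rewrite in_itv/= andbT => x0; rewrite ger0_norm// h0.
Qed.

Lemma integrable_mass x : lebesgue_measure.-integrable `]0, x] (EFin \o h).
Proof. by apply: integrableS integrable_half_line; last exact: sub0oo. Qed.

Lemma continuous_mass b : 0 <= b -> {within `[0, b], continuous F}.
Proof.
move=> b0; have m0b : measurable_fun `[0, b] h by exact: measurable_funTS.
have FE : F = (parameterized_integral lebesgue_measure 0)^~ h.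
  by apply/funext => x; apply/Rintegral_itv_obnd_cbnd/integrable_mass.
rewrite FE; apply: parameterized_integral_continuous => //.
apply/integrableP; split; first exact/measurable_EFinP.
rewrite -integral_itv_obnd_cbnd; last first.
  by apply: measurableT_comp => //; apply/measurable_EFinP; exact: measurable_funTS.
by have /integrableP[] := integrable_mass b.
Qed.

Let massE x : (\int[lebesgue_measure]_(s in `]0%R, x]) (h s)%:E = (F x)%:E)%E.
Proof.
by rewrite /F /Rintegral fineK//; apply/integrable_fin_num/integrable_mass.
Qed.

(** Otherwise monotone convergence along the intervals []0, n]] would bound the total mass [I] by
    [c]. *)
Lemma mass_cvg c : c < I -> exists n : nat, c < F n%:R.
Proof.
move=> cI; apply: contrapT => /forallNP nF.
have : (\int[lebesgue_measure]_(x in \bigcup_n `]0%R, n%:R]%classic) (h x)%:E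
    <= c%:E)%E.
  apply: (cvge_to_le (ge0_nondecreasing_set_cvg_integral _ _ _ _)) => //.
  - move=> m n mn; apply/subsetPset/subset_itvl.
    by rewrite bnd_simp ler_nat.
  - by move=> n; apply/measurable_EFinP; exact: measurable_funTS.
  - by move=> n x /=; rewrite in_itv/= => /andP[x0 _]; rewrite lee_fin h0.
  - by apply: nearW => n; rewrite massE lee_fin leNgt; exact/negP/nF.
have -> : \bigcup_n `]0, n%:R]%classic = `]0, +oo[%classic :> set R.
  apply/seteqP; split => [x [n _]|x /=]; first exact: sub0oo.
  rewrite in_itv/= andbT => x0; exists (Num.truncn x).+1 => //=.
  by rewrite in_itv/= x0 ltW// truncnS_gt.
by rewrite hI lee_fin leNgt cI.
Qed.

Lemma mass_homo x y : x <= y -> F x <= F y.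
Proof.
move=> xy; have xyS : (`]0, x] : set R) `<=` `]0, y].
  by apply: subset_itvl; rewrite bnd_simp.
apply: fine_le; [exact/integrable_fin_num/integrable_mass..|].
apply: ge0_subset_integral => //.
  by apply/measurable_EFinP; exact: measurable_funTS.
by move=> z /=; rewrite in_itv/= => /andP[z0 _]; rewrite lee_fin h0.
Qed.

Lemma mass_IVT a b c : 0 <= a -> a <= b -> F a <= c -> c <= F b ->
  exists2 m, a <= m <= b & F m = c.
Proof.
move=> a0 ab Fac cFb; have cF := continuous_mass (le_trans a0 ab).
have [| |m mab <-] := @IVT _ F a b c ab.
- by apply: continuous_subspaceW cF; apply: subset_itvr; rewrite bnd_simp.
- by rewrite ge_min le_max Fac cFb orbT.
- by exists m.
Qed.

Lemma mass_value_above x c : 0 <= x -> F x <= c -> c < I ->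
  exists2 m, x <= m & F m = c.
Proof.
move=> x0 Fx cI; have [n cF] := mass_cvg cI.
have xn : x <= n%:R.
  by rewrite leNgt; apply/negP => /ltW/mass_homo; rewrite leNgt (le_lt_trans Fx).
have [m /andP[xm _] <-] := mass_IVT x0 xn Fx (ltW cF).
by exists m.
Qed.

Lemma mass_value_below x c : 0 <= x -> 0 <= c -> c <= F x ->
  exists2 m, m <= x & F m = c.
Proof.
move=> x0 c0 cFx; have F0 : F 0 <= c.
  by rewrite /F set_itv_ge ?bnd_simp// Rintegral_set0.
have [m /andP[_ mx] <-] := mass_IVT (lexx 0) x0 F0 cFx.
by exists m.
Qed.

Let le_mass (A S : set R) : measurable A -> measurable S ->
  A `<=` `]0, +oo[ `&` S ->
  (\int[lebesgue_measure]_(s in A) (h s)%:E <=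
   \int[lebesgue_measure]_(s in `]0%R, +oo[ `&` S) (h s)%:E)%E.
Proof.
move=> mA mS AS; apply: ge0_subset_integral => //.
- exact: measurableI.
- by apply/measurable_EFinP; exact: measurable_funTS.
- by move=> s [+ _]; rewrite /= in_itv/= andbT lee_fin; exact: h0.
Qed.

(** If [F x <= I / 2], continuity would give a half-mass point [m >= x > u]. Strictness comes from
    [u < x], without uniqueness of the median. *)
Lemma mass_gt_half_below (u x : R) (S : set R) : 0 < I -> measurable S ->
  (forall m, F m = I / 2 -> m <= u) -> u < x -> 0 <= x ->
  (forall s, 0 < s -> s <= x -> S s) ->
  ((I / 2)%:E < \int[lebesgue_measure]_(s in `]0%R, +oo[ `&` S) (h s)%:E)%E.
Proof.
move=> I0 mS hu ux x0 xS; apply: (@lt_le_trans _ _ (F x)%:E).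
  rewrite lte_fin ltNge; apply/negP => Fx.
  have [|m xm /hu mu] := mass_value_above x0 Fx; first by lra.
  by have := lt_le_trans ux (le_trans xm mu); rewrite ltxx.
rewrite -massE; apply: le_mass => // s; rewrite /= in_itv/= => /andP[s0 sx].
by split; [rewrite in_itv/= s0|exact: xS].
Qed.

(** If [F x >= I / 2], there would be a half-mass point [m <= x < l]. Hence [F x < I / 2], and the
    tail beyond [x], of mass [I - F x], exceeds one half of [I]. *)
Lemma mass_gt_half_above (l x : R) (S : set R) : 0 < I -> measurable S ->
  (forall m, F m = I / 2 -> l <= m) -> x < l -> 0 <= x ->
  (forall s, x <= s -> S s) ->
  ((I / 2)%:E < \int[lebesgue_measure]_(s in `]0%R, +oo[ `&` S) (h s)%:E)%E.
Proof.
move=> I0 mS hl xl x0 xS.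
have Fx : F x < I / 2.
  rewrite ltNge; apply/negP => Fx.
  have [|m mx /hl lm] := mass_value_below x0 _ Fx; first by lra.
  by have := lt_le_trans xl (le_trans lm mx); rewrite ltxx.
apply: (@lt_le_trans _ _ (\int[lebesgue_measure]_(s in `]x, +oo[) (h s)%:E)%E).
  have := hI; rewrite (@itv_bndbnd_setU _ _ _ (BRight x)) ?bnd_simp//.
  rewrite ge0_integral_setU//=.
  - rewrite massE; case: (\int[_]_(_ in _) _)%E => [r [Fr]|//|//].
    by rewrite lte_fin; lra.
  - by apply/measurable_EFinP; exact: measurable_funTS.
  - move=> s; rewrite /= !in_itv/= andbT lee_fin.
    by move=> -[/andP[/h0]|/(le_lt_trans x0)/h0].
  - apply/disj_setPS => s [/=]; rewrite !in_itv/= andbT => /andP[_ sx].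
    by rewrite ltNge sx.
apply: le_mass => // s; rewrite /= !in_itv/= !andbT => xs.
by split; [exact: le_lt_trans xs|exact/xS/ltW].
Qed.

End half_mass.

(* The joint density at (t, s) of (X2 / X1, X2 / th.2) when lam = th.2 / th.1. *)
Definition ratio_kernel (R : realType) (f : R * R -> R) (lam t s : R) : R :=
  lam * s / t ^+ 2 * f (lam * s / t, s).

(** * Joint law of the ratio and the rescaled second coordinate *)

Section ratio_scale_law.
Context (R : realType) (f : R * R -> R).
Hypotheses (mf : measurable_fun setT f) (f0 : forall x, 0 <= f x).

Lemma ratio_kernel_ge0 lam t s : 0 < lam -> 0 < t -> 0 < s ->
  0 <= ratio_kernel f lam t s.
Proof.
move=> l0 t0 s0; rewrite /ratio_kernel mulr_ge0// !mulr_ge0//.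
- exact: ltW.
- exact: ltW.
- by rewrite invr_ge0 exprn_ge0// ltW.
Qed.

Lemma measurable_ratio_kernel lam :
  measurable_fun setT (fun z : R * R => ratio_kernel f lam z.1 z.2).
Proof.
have mV : measurable_fun setT (fun z : R * R => z.1^-1).
  exact: (measurableT_comp (@measurable_funV R)).
have ml : measurable_fun setT (fun z : R * R => lam * z.2).
  by apply: measurable_funM.
apply: measurable_funM.
  apply: measurable_funM => //; under eq_fun do rewrite -exprVn.
  exact: measurable_funX.
apply: (measurableT_comp mf); apply: measurable_fun_pair => //.
exact: measurable_funM.
Qed.

Lemma measurable_ratio_scale (b : R) :
  measurable_fun setT (fun x : R * R => (x.2 / x.1, x.2 / b)).
Proof.
apply: measurable_fun_pair; apply: measurable_funM => //.
exact: (measurableT_comp (@measurable_funV R)).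
Qed.

(** Cutting to the open quadrant makes the integrand vanish outside it, as [integral_quadrant]
    requires; [X] takes its values there, so no probability is lost. *)
Definition quadrant_preimage (b : R) (A : set (R * R)) : set (R * R) :=
  (`]0, +oo[ `*` `]0, +oo[) `&` (fun x => (x.2 / x.1, x.2 / b)) @^-1` A.

Lemma measurable_quadrant_preimage b A : measurable A ->
  measurable (quadrant_preimage b A).
Proof.
move=> mA; apply: measurableI; first exact: measurableX.
by rewrite -[X in measurable X]setTI; exact: measurable_ratio_scale.
Qed.

(** In [integral_quadrant] with [b = th.2], the Jacobian [th.2 ^ 2 * s / t ^ 2] divided by
    [th.1 * th.2] is the factor [lam * s / t ^ 2] of the kernel, for [lam = th.2 / th.1]. *)
Lemma integral_scale_density (th : R * R) (A : set (R * R)) :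
  0 < th.1 -> 0 < th.2 -> measurable A ->
  (\int[@lebesgue2 R]_(x in quadrant_preimage th.2 A) (scale_density f th x)%:E =
   \int[lebesgue_measure]_(t in `]0%R, +oo[)
     \int[lebesgue_measure]_(s in `]0%R, +oo[ `&` xsection A t)
       (ratio_kernel f (th.2 / th.1) t s)%:E)%E.
Proof.
move=> th10 th20 mA; rewrite integral_mkcond.
have mQ := measurable_quadrant_preimage th.2 mA.
have msd : measurable_fun setT (scale_density f th).
  apply: measurable_funM => //; apply: (measurableT_comp mf).
  by apply: measurable_fun_pair; exact: measurable_funM.
rewrite (integral_quadrant th20); last 3 first.
- apply/(measurable_restrictT _ mQ); apply/measurable_EFinP.
  exact: measurable_funTS.
- move=> x; apply: erestrict_ge0 => y _; rewrite lee_fin mulr_ge0//.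
  by rewrite invr_ge0 mulr_ge0// ltW.
- move=> x nx; rewrite patchE memNset// => -[[/= + +] _].
  by rewrite !in_itv/= !andbT => x1 x2; apply: nx.
apply: eq_integral => t /[!inE]/=; rewrite in_itv/= andbT => t0.
rewrite integral_mkcondr; apply: eq_integral => s /[!inE]/=.
rewrite in_itv/= andbT => s0; rewrite !patchE.
have -> : ((th.2 / t * s, th.2 * s) \in quadrant_preimage th.2 A) =
    (s \in xsection A t).
  rewrite mem_xsection; apply/idP/idP; rewrite !inE /quadrant_preimage /=.
    move=> [_]; congr A; congr pair; field; rewrite ?gt_eqF//.
  move=> Ats; split; first by rewrite !in_itv/= !andbT !mulr_gt0// invr_gt0.
  by move: Ats; congr A; congr pair; field; rewrite ?gt_eqF//.
case: ifPn => _; last by rewrite mule0.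
rewrite -EFinM /scale_density /ratio_kernel/=; congr EFin.
have -> : th.2 / t * s / th.1 = th.2 / th.1 * s / t by field; rewrite ?gt_eqF.
have -> : th.2 * s / th.2 = s by field; rewrite ?gt_eqF.
by field; rewrite ?gt_eqF.
Qed.

(** Partial integrals of a nonnegative measurable function are measurable by Tonelli; the kernel
    becomes one after being cut to the part of [A] in the open quadrant. *)
Lemma measurable_section_mass lam (A : set (R * R)) : 0 < lam -> measurable A ->
  measurable_fun (`]0, +oo[ : set R) (fun t =>
    \int[lebesgue_measure]_(s in `]0%R, +oo[ `&` xsection A t)
      (ratio_kernel f lam t s)%:E)%E.
Proof.
move=> lam0 mA; pose Q : set (R * R) := (`]0, +oo[ `*` `]0, +oo[) `&` A.
have mQ : measurable Q by apply: measurableI => //; exact: measurableX.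
pose k := (fun z : R * R => (ratio_kernel f lam z.1 z.2)%:E) \_ Q.
have mk : measurable_fun setT k.
  apply/(measurable_restrictT _ mQ); apply/measurable_EFinP.
  by apply: measurable_funTS; exact: measurable_ratio_kernel.
have k0 z : (0 <= k z)%E.
  apply: erestrict_ge0 => -[t s] [[/= + +] _].
  by rewrite !in_itv/= !andbT lee_fin => t0 s0; exact: ratio_kernel_ge0.
have := measurable_fun_fubini_tonelli_F (m2 := @lebesgue_measure R) k mk k0.
move/(measurable_funS measurableT (@subsetT _ (`]0, +oo[ : set R))).
apply: eq_measurable_fun => t /[!inE]/= t0.
rewrite /fubini_F [RHS]integral_mkcond; apply: eq_integral => s _.
rewrite /k !patchE/=; congr (if _ then _ else _).
by apply/idP/idP; rewrite !inE /Q /= /xsection/= ?inE; [move=> [[]]|move=> []].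
Qed.

End ratio_scale_law.

(** * Comparison of the two estimators given the value of the ratio *)

Lemma win_mass_gt_half (R : realType) (f : R * R -> R) (W : R -> R)
    (lam t I l u p p' : R) (S : set R) :
  measurable_fun setT f -> (forall x, 0 <= f x) ->
  general_loss W -> {for 1, continuous W} ->
  0 < lam -> 0 < t -> 0 < I -> 0 < l -> 0 < p -> 0 < p' ->
  (\int[lebesgue_measure]_(s in `]0%R, +oo[) (ratio_kernel f lam t s)%:E
   = I%:E)%E ->
  (forall m, cond_median f lam t m -> l <= m <= u) ->
  (p < u^-1 -> p < p' <= u^-1) -> (l^-1 < p -> l^-1 <= p' < p) ->
  (u^-1 <= p <= l^-1 -> p' = p) -> p' != p ->
  measurable S -> (forall s, 0 < s -> W (p' * s) < W (p * s) -> S s) ->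
  ((I / 2)%:E <
   \int[lebesgue_measure]_(s in `]0%R, +oo[ `&` S) (ratio_kernel f lam t s)%:E)%E.
Proof.
move=> mf f0 hW cW lam0 t0 I0 l0 p0 p'0 GI hmed lo hi mid p'p mS winS.
have mq : measurable_fun setT (ratio_kernel f lam t).
  exact: (measurableT_comp (measurable_ratio_kernel mf lam) (pair1_measurable t)).
have q0 s : 0 < s -> 0 <= ratio_kernel f lam t s.
  by move=> s0; exact: ratio_kernel_ge0.
(* Division by the total mass [I] turns a half-mass point of the kernel into a conditional
   median. *)
have med m : \int[lebesgue_measure]_(s in `]0, m]) ratio_kernel f lam t s = I / 2 ->
    l <= m <= u.
  move=> Fm; apply: hmed; rewrite /cond_median.
  have dE : ratio_density f lam t = I by rewrite /ratio_density /Rintegral GI.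
  transitivity ((\int[lebesgue_measure]_(s in `]0, m]) ratio_kernel f lam t s) / I).
    rewrite -RintegralZr ?dE//; first by rewrite /cond_density dE.
    exact: (integrable_mass mq q0 GI).
  by rewrite Fm; field; rewrite gt_eqF.
(* If [p < u^-1], the new multiplier [p'] is larger and wins for all [s] up to some [x > u]. *)
have [pu|up] := ltP p u^-1.
  have /andP[pp' p'u] := lo pu.
  have u0 : 0 < u by rewrite -invr_gt0 (lt_trans p0).
  have [x px winx] := loss_better_low hW cW p0 pp'.
  have ux : u < x.
    by apply: le_lt_trans px; rewrite -[u]invrK lef_pV2 ?posrE ?invr_gt0.
  apply: (mass_gt_half_below mq q0 GI I0 mS _ ux).
  - by move=> m /med /andP[].
  - exact/ltW/(lt_trans u0).
  - by move=> s s0 sx; exact/winS/winx.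
(* Between the bounds [p' = p], which is excluded. What remains is a smaller [p'], which wins from
   some [x < l] on. *)
have [pl|lp] := leP p l^-1; first by rewrite mid ?eqxx ?up ?pl in p'p.
have /andP[lp' p'p1] := hi lp.
have [x [x0 xp winx]] := loss_better_high hW cW p'0 p'p1.
have xl : x < l.
  by apply: lt_le_trans xp _; rewrite -[l]invrK lef_pV2 ?posrE ?invr_gt0.
apply: (mass_gt_half_above mq q0 GI I0 mS _ xl (ltW x0)).
- by move=> m /med /andP[].
- by move=> s xs; apply/winS/winx => //; exact: lt_le_trans xs.
Qed.

(** * Integration of the conditional comparison over the ratio *)

Theorem corollary4p2p1 (R : realType) (d : measure_display)
    (T : measurableType d) (P : R * R -> probability T R) (X : T -> R * R)
    (f : R * R -> R) (W l u psi psi20 : R -> R)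
    (hf : planar_pdf f)
    (mX : measurable_fun setT X)
    (X_gt0 : forall w, 0 < (X w).1 /\ 0 < (X w).2)
    (X_density : forall th, Theta0 th -> forall A : set (R * R), measurable A ->
      P th (X @^-1` A)
      = (\int[@lebesgue2 R]_(x in A) (scale_density f th x)%:E)%E)
    (hW : general_loss W)
    (W_cont1 : {for 1, continuous W})
    (l_gt0 : forall t : R, 0 < t -> 0 < l t)
    (hlu : forall lam t m, 1 <= lam -> ratio_support f lam t ->
      cond_median f lam t m -> l t <= m <= u t)
    (mpsi : measurable_fun (`]0, +oo[%classic : set R) psi)
    (psi_gt0 : forall t : R, 0 < t -> 0 < psi t)
    (mpsi20 : measurable_fun (`]0, +oo[%classic : set R) psi20)
    (psi20_gt0 : forall t : R, 0 < t -> 0 < psi20 t)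
    (psi20_lo : forall t : R, 0 < t -> psi t < (u t)^-1 ->
      psi t < psi20 t <= (u t)^-1)
    (psi20_hi : forall t : R, 0 < t -> (l t)^-1 < psi t ->
      (l t)^-1 <= psi20 t < psi t)
    (psi20_mid : forall t : R, 0 < t -> (u t)^-1 <= psi t <= (l t)^-1 ->
      psi20 t = psi t)
    (hlt1 : forall th, Theta0 th ->
      (P th [set w | ((u (coord_ratio (X w)))^-1 <= psi (coord_ratio (X w))
                       <= (l (coord_ratio (X w)))^-1)%R] < 1)%E) :
  forall th, Theta0 th ->
    ((2^-1)%:E < GPN P X W (scale_equivariant psi20) (scale_equivariant psi) th)%E.
Proof.
move=> th [th10 th20 th12]; have [mf f0 _] := hf.
pose lam := th.2 / th.1; pose p := P th.
have lam0 : 0 < lam by rewrite divr_gt0.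
have lam1 : 1 <= lam by rewrite ler_pdivlMr// mul1r.
pose D : set R := `]0, +oo[%classic.
have mD : measurable D by exact: measurable_itv.
(* The density of the ratio at [t] restricted to the event [A]; divided by [mass setT t], when
   positive and finite, it is the conditional probability of [A]. *)
pose mass (A : set (R * R)) t :=
  (\int[lebesgue_measure]_(s in `]0%R, +oo[ `&` xsection A t)
    (ratio_kernel f lam t s)%:E)%E.
have mass0 A t : D t -> (0 <= mass A t)%E.
  rewrite /D/= in_itv/= andbT => t0; apply: integral_ge0 => s [+ _].
  by rewrite /= in_itv/= andbT lee_fin => s0; exact: ratio_kernel_ge0.
have mmass A : measurable A -> measurable_fun D (mass A).
  by move=> mA; exact: measurable_section_mass.
have pE A : measurable A ->
    p [set w | A ((X w).2 / (X w).1, (X w).2 / th.2)]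
    = (\int[lebesgue_measure]_(t in D) mass A t)%E.
  move=> mA; rewrite -integral_scale_density// -X_density//; last first.
    exact: measurable_quadrant_preimage.
  congr (p _); apply/seteqP; split=> [w Aw|w [_]//]; split=> //=.
  by have [x1 x2] := X_gt0 w; rewrite !in_itv/= x1 x2.
(* Extension by 0 gives functions measurable on the whole line that agree with the originals at all
   arguments that occur. *)
pose ps := psi \_ D; pose ps0 := psi20 \_ D; pose W' := W \_ D.
have mps : measurable_fun setT ps by exact/(measurable_restrictT _ mD).
have mps0 : measurable_fun setT ps0 by exact/(measurable_restrictT _ mD).
have mW' : measurable_fun setT W'.
  apply/(measurable_restrictT _ mD); apply: quasiconvex_measurable.
    exact: interval_is_interval.
  move=> x y z; rewrite /D/= !in_itv/= !andbT => x0 _ /andP[xy yz].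
  exact: loss_quasiconvex.
pose a (g : R -> R) (z : R * R) := W' (g z.1 * z.2).
have ma g : measurable_fun setT g -> measurable_fun setT (a g).
  move=> mg; apply: (measurableT_comp mW'); apply: measurable_funM => //.
  exact: measurableT_comp.
have aE (g : R -> R) (t s : R) : 0 < t -> 0 < s -> 0 < g t ->
    a (g \_ D) (t, s) = W (g t * s).
  move=> t0 s0 g0; rewrite /a /W' !patchE !mem_set//= /D/= in_itv/= andbT//.
  by rewrite mulr_gt0.
pose Awin : set (R * R) := [set z | a ps0 z < a ps z].
pose Atie : set (R * R) := [set z | a ps0 z = a ps z].
have mbool (B : set bool) : measurable B by [].
have mAwin : measurable Awin.
  have := measurable_fun_ltr (ma _ mps0) (ma _ mps) measurableT (mbool [set true]).
  by rewrite setTI; congr measurable; apply/seteqP; split.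
have mAtie : measurable Atie.
  have := measurable_fun_eqr (ma _ mps0) (ma _ mps) measurableT (mbool [set true]).
  by rewrite setTI; congr measurable; apply/seteqP; split => z /= /eqP.
pose N : set R := [set t | ps0 t != ps t].
have mN : measurable N.
  have := measurable_fun_eqr mps0 mps measurableT (mbool [set false]).
  by rewrite setTI; congr measurable; apply/seteqP; split=> z /=;
    rewrite /N/=; [move=> ->|move/negbTE].
have mNT : measurable (N `*` [set: R]) by exact: measurableX.
have xT t : xsection [set: R * R] t = setT.
  by apply/seteqP; split=> s _ //; rewrite /xsection/= inE.
pose G := mass setT.
have halfG t : ((2^-1)%:E * G t < +oo)%E -> (G t < +oo)%E.
  by case: (G t) => [r _||//]; [exact: ltry|rewrite gt0_muley ?lte_fin].
have GD : (\int[lebesgue_measure]_(t in D) G t = 1)%E.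
  by rewrite -pE// -(@probability_setT _ _ _ p).
have lossE (g : R -> R) w : 0 < g (coord_ratio (X w)) ->
  loss2 W th (scale_equivariant g (X w)) =
  a (g \_ D) ((X w).2 / (X w).1, (X w).2 / th.2).
  move=> g0; have [x1 x2] := X_gt0 w.
  by rewrite aE ?divr_gt0// /loss2 /scale_equivariant mulrA.
have rX w : 0 < coord_ratio (X w) by have [x1 x2] := X_gt0 w; rewrite divr_gt0.
(* Both sides of the claim become integrals over [t]: of wins plus half the ties, and of one half of
   [G]. *)
have -> : GPN P X W (scale_equivariant psi20) (scale_equivariant psi) th =
    (\int[lebesgue_measure]_(t in D) (mass Awin t + (2^-1)%:E * mass Atie t))%E.
  rewrite ge0_integralD//; last 4 first.
  - by move=> t; exact: mass0.
  - exact: mmass.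
  - by move=> t Dt; rewrite mule_ge0// ?mass0// lee_fin.
  - by apply: measurable_funeM; exact: mmass.
  rewrite ge0_integralZl//; last first.
  - by move=> t; exact: mass0.
  - exact: mmass.
  rewrite -!pE//; congr (p _ + _ * p _)%E;
    by apply/seteqP; split=> w /=; rewrite !lossE ?psi_gt0 ?psi20_gt0.
rewrite [ltLHS](_ : _ =
    \int[lebesgue_measure]_(t in D) ((2^-1)%:E * G t))%E; last first.
  rewrite ge0_integralZl//; first by rewrite GD mule1.
  - exact: mmass.
  - by move=> t; exact: mass0.
have psE t : D t -> ps t = psi t /\ ps0 t = psi20 t.
  by move=> Dt; rewrite /ps /ps0 !patchE !mem_set.
(* A positive finite [G t] puts [t] in the support of the ratio, where the median bounds apply. *)
have strict t : D t -> N t -> (0 < G t)%E -> (G t < +oo)%E ->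
    ((2^-1)%:E * G t < mass Awin t)%E.
  move=> Dt; have [psE1 psE2] := psE t Dt.
  move=> Nt; have := erefl (G t); case: {2 3 4 5}(G t) => [I| |]// GI I0 _.
  have t0 : 0 < t by move: Dt; rewrite /D/= in_itv/= andbT.
  rewrite lte_fin in I0.
  have qI : (\int[lebesgue_measure]_(s in `]0%R, +oo[)
      (ratio_kernel f lam t s)%:E = I%:E)%E.
    by rewrite -GI /G /mass xT setIT.
  rewrite -EFinM mulrC.
  apply: (@win_mass_gt_half _ f W lam t I (l t) (u t) (psi t) (psi20 t)) => //.
  - exact: l_gt0.
  - exact: psi_gt0.
  - exact: psi20_gt0.
  - move=> m; apply: hlu => //; split => //.
    by rewrite /ratio_density /Rintegral qI.
  - exact: psi20_lo.
  - exact: psi20_hi.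
  - exact: psi20_mid.
  - by move: Nt; rewrite /N/= psE1 psE2.
  - exact: measurable_xsection.
  - move=> s s0 Ws; rewrite /xsection /= inE /Awin/= !aE//.
    + exact: psi_gt0.
    + exact: psi20_gt0.
(* Strictness is needed only on [N], where the multipliers differ; the last obligation is that [N]
   carries positive mass. *)
apply: (@ge0_lt_integral _ _ R lebesgue_measure D (D `&` N)
  (fun t => (2^-1)%:E * G t)
  (fun t => mass Awin t + (2^-1)%:E * mass Atie t))%E => //.
- exact: measurableI.
- by apply: measurable_funeM; exact: mmass.
- apply: emeasurable_funD; first exact: mmass.
  by apply: measurable_funeM; exact: mmass.
- by move=> t Dt; rewrite mule_ge0// ?mass0// lee_fin.
- by move=> t Dt; rewrite adde_ge0 ?mass0// mule_ge0// ?mass0// lee_fin.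
- rewrite ge0_integralZl//; first by rewrite GD mule1 ltry.
    exact: mmass.
  by move=> t; exact: mass0.
- move=> t Dt Goo.
  have [Nt|/negPn/eqP eqt] := boolP (ps0 t != ps t).
    have [G0|G0] := eqVneq (G t) 0%E.
      by rewrite G0 mule0 adde_ge0 ?mass0// mule_ge0// ?mass0// lee_fin.
    apply: (@le_trans _ _ (mass Awin t)).
      apply/ltW/strict => //; first by rewrite lt0e G0 mass0.
      exact: halfG.
    by rewrite leeDl// mule_ge0// ?mass0// lee_fin.
  (* Equal multipliers tie for every [s], so the ties alone contribute half of [G t]. *)
  suff -> : mass Atie t = G t by rewrite leeDr// mass0.
  rewrite /mass; congr (integral _ _ _); apply/seteqP; split=> s [s0 _]; split=> //=.
    by rewrite /xsection/= inE.
  by rewrite /xsection/= inE /Atie/= /a/= eqt.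
- move=> t [Dt Nt] G0 Goo; apply: (@lt_le_trans _ _ (mass Awin t)).
    apply: strict => //; first by rewrite pmule_rgt0// lte_fin in G0.
    exact: halfG.
  by rewrite leeDl// mule_ge0// ?mass0// lee_fin.
rewrite ge0_integralZl//; last 3 first.
- exact: measurableI.
- by apply: measurable_funS (mmass _ measurableT) => //; exact: subIsetl.
- by move=> t [Dt _]; exact: mass0.
rewrite mule_gt0// ?lte_fin//.
have -> : (\int[lebesgue_measure]_(t in D `&` N) G t
    = p [set w | N (coord_ratio (X w))])%E.
  rewrite integral_mkcondr.
  transitivity (\int[lebesgue_measure]_(t in D) mass (N `*` setT) t)%E.
    apply: eq_integral => t _; rewrite patchE; case: ifPn => Nt.
      by rewrite /G /mass xT in_xsectionX.
    by rewrite /mass notin_xsectionX// setI0 integral_set0.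
  by rewrite -pE//; congr (p _); apply/seteqP; split=> w //= [].
have mNX : measurable [set w | N (coord_ratio (X w))].
  have := (measurableT_comp (measurable_ratio_scale th.2) mX) measurableT _ mNT.
  by rewrite setTI; congr measurable; apply/seteqP; split=> w //= [].
(* If the multipliers agreed almost surely, the event in [hlt1] would have probability 1. *)
rewrite lt0e measure_ge0 andbT; apply/eqP => pN0.
have := hlt1 th (And3 th10 th20 th12).
(* u and l need not be measurable, but this event is {psi20 D = psi D}. *)
rewrite (_ : [set w | _] = ~` [set w | N (coord_ratio (X w))]); last first.
  apply/seteqP; split=> w /=;
    have [|psE1 psE2] := psE (coord_ratio (X w)); rewrite ?/D/= ?in_itv/= ?andbT//.
    by move=> mid; rewrite /N/= psE1 psE2 psi20_mid// eqxx.
  rewrite /N/= psE1 psE2 => /negP/negPn/eqP eqt; apply/andP; split.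
    rewrite leNgt; apply/negP => /(psi20_lo _ (rX w)) /andP[+ _].
    by rewrite eqt ltxx.
  rewrite leNgt; apply/negP => /(psi20_hi _ (rX w)) /andP[_].
  by rewrite eqt ltxx.
by rewrite probability_setC// -/p pN0 sube0 ltxx.
Qed.
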